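(* Let $\lambda$ be a partition of $N$ and let $W^\lambda$ be the corresponding irreducible complex representation (Specht module) of $S_N$. For generic $z=(z_1,\dots,z_N)\in\mathbb C^N$ with pairwise distinct coordinates (that is, for all $z$ in some nonempty Zariski open subset of $\{z\in\mathbb C^N : z_i\neq z_j \text{ for } i\neq j\}$), the operators $$\theta_i=\sum_{j\ne i}\frac{s_{ij}}{z_i-z_j},\qquad 1\le i\le N,$$ act semisimply on $W^\lambda$.
   Context: $s_{ij}\in S_N$ is the transposition swapping $i$ and $j$; the elements $\theta_i\in\mathbb C[S_N]$ pairwise commute for each $z$ with distinct coordinates. A family of commuting operators on a finite-dimensional complex vector space acts semisimply if there is a basis of the space in which all of them are diagonal. *)

(* Defs.v *)
From mathcomp Require Export all_boot all_order all_algebra all_fingroup.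
From mathcomp Require Export all_character.
From mathcomp Require Export classical_sets reals complex mpoly.

Set Implicit Arguments.
Unset Strict Implicit.
Unset Printing Implicit Defensive.

Import GRing.Theory.
Local Open Scope ring_scope.

Definition is_partition (N : nat) (la : seq nat) : bool :=
  [&& sorted geq la, all (leq 1) la & sumn la == N].

Section Specht.
Variables (K : fieldType) (N : nat) (la : seq nat).

(* The canonical Young tableau of shape la puts the entries 0, .., N-1 in the
   diagram row by row: entry i lies in row [reshape_index la i] and in column
   [reshape_offset la i].  The next two sets are its row and column
   stabilizers. *)
Definition young_row : {set 'S_N} :=
  [set s : 'S_N | [forall i : 'I_N,
     reshape_index la (s i) == reshape_index la i]].

Definition young_col : {set 'S_N} :=
  [set s : 'S_N | [forall i : 'I_N,
     reshape_offset la (s i) == reshape_offset la i]].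

Let aG := regular_repr K [set: 'S_N]%G.

(* The Young symmetrizer c = a b of K[S_N], where a is the sum of the row
   stabilizer and b the signed sum of the column stabilizer.  The product of
   permutations in MathComp is composition in reverse order, (s * t) i = t (s i),
   so a b for the usual composition is [b *m a] here. *)
Definition young_symmetrizer : 'rV[K]_(gcard [set: 'S_N]%G) :=
  gring_row ((\sum_(s in young_col) (-1) ^+ s *: aG s)
             *m (\sum_(s in young_row) aG s)).

(* The Specht module K[S_N] c.  Representations in MathComp act on row vectors
   on the right; through the reversal of products above, the left ideal
   generated by c is the cyclic submodule of the regular representation. *)
Definition specht := submod_repr (cyclic_mx_module aG young_symmetrizer).

End Specht.

Definition theta (K : fieldType) (N n : nat)
    (rG : mx_representation K [set: 'S_N]%G n) (z : 'I_N -> K) (i : 'I_N) :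
    'M[K]_n :=
  \sum_(j < N | j != i) (z i - z j)^-1 *: rG (tperm i j).

Definition distinct_coords (K : fieldType) (N : nat) : set ('I_N -> K) :=
  [set z : 'I_N -> K | injective z]%classic.

Definition zariski_open (K : fieldType) (N : nat) (O : set ('I_N -> K)) : Prop :=
  exists S : set {mpoly K[N]},
    O = [set z : 'I_N -> K | exists2 p, S p & p.@[z] != 0]%classic.

Definition zariski_open_in (K : fieldType) (N : nat)
    (X U : set ('I_N -> K)) : Prop :=
  exists2 O, zariski_open O & U = (X `&` O)%classic.

(* Main.v *)
Require Import Defs.
From mathcomp Require Import boolp ring zify.

Set Implicit Arguments.
Unset Strict Implicit.
Unset Printing Implicit Defensive.

Import Order.TTheory GRing.Theory Num.Theory.
Local Open Scope ring_scope.

(** The argument has two halves: the theta_i are diagonalizable at real points,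
    and diagonalizability can be transported from real points to generic ones.

    For an endomorphism A of an n-dimensional space, the span of its powers
    carries the trace form (X, Y) |-> tr (X Y), whose Gram matrix on the powers
    A^0, .., A^(n-1) is [traces_mx A n]. Over an algebraically closed field,
    if this form is nondegenerate then A is diagonalizable: a repeated factor of
    the minimal polynomial would give a nonzero square-zero element q(A), all of
    whose multiples q(A) A^j also have square zero, hence trace zero
    ([diagonalizable_traces]). In terms of ranks, nondegeneracy says
      rank [powers_mx A n] <= rank [traces_mx A n].
    When A is self-adjoint for a positive definite hermitian form, this holds
    because tr (X X') > 0 for the adjoint X' of a nonzero X, which is again a
    polynomial in A ([rank_traces_adjointable]). Transpositions are unitary
    involutions for an S_N-invariant form, so their real linear combinations
    are self-adjoint ([rank_traces_transpositions]).

    Both ranks are lower semicontinuous in the Zariski topology when A depends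
    polynomially on z ([rank_semicontinuous]). Let r be the largest rank of
    [powers_mx (A z) n] over all z. It is attained on a nonempty Zariski open
    set, hence at a real point, since real points are Zariski dense
    ([meval_real_point]). There the rank of [traces_mx (A z) n] is at least r,
    and it remains so on a nonempty Zariski open set, on which it is therefore
    at least the rank of [powers_mx (A z) n] and A z is diagonalizable
    ([diagonalizable_dense]).

    This is applied to each theta_i with its denominators cleared. The finitely
    many open sets obtained have a common point, the theta_i commute
    ([theta_comm]), and commuting diagonalizable matrices are simultaneously
    diagonalizable. This is [theta_generically_semisimple], for an arbitrary
    finite-dimensional representation of S_N, of which the Specht modules are
    instances. *)

Local Notation adj A := (map_mx Num.conj A^T).

(** * Diagonalizability and the trace form *)

Lemma diagonalizableZ (K : fieldType) n (c : K) (A : 'M[K]_n) :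
  diagonalizable A -> diagonalizable (c *: A).
Proof.
move=> [P Punit /similar_diagPex[D /(similarP Punit) PA]].
exists P => //; apply/similar_diagPex; exists (c *: D).
by apply/similarP; rewrite // [diag_mx _]linearZ /= -scalemxAl -scalemxAr PA.
Qed.

Lemma horner_rVpoly_sum (R : comNzRingType) (n' : nat) (A : 'M[R]_n'.+1)
    (d : nat) (u : 'rV_d) :
  horner_mx A (rVpoly u) = \sum_i u 0 i *: A ^+ i.
Proof.
rewrite [rVpoly u]poly_def linear_sum; apply: eq_bigr => i _.
by rewrite valK /= linearZ rmorphXn /= horner_mx_X.
Qed.

Section TraceForm.

Variables (F : fieldType) (n' : nat).
Local Notation n := n'.+1.
Implicit Type A : 'M[F]_n.

(** Take a full-rank factorization A = L R: then A^2 = 0 forces R L = 0, and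
    tr (L R) = tr (R L). *)
Lemma mxtrace_square_zero (m : nat) (A : 'M[F]_m) : A *m A = 0 -> \tr A = 0.
Proof.
move=> A2; have [C CA] := row_fullP (col_base_full A).
have [D AD] := row_freeP (row_base_free A).
move: (mulmx_base A) C CA D AD; move: (col_base A) (row_base A).
move: (\rank A) => r L R defA C CL D RD; move: A2; rewrite -{}defA => LRLR.
rewrite mxtrace_mulC (_ : R *m L = 0) ?mxtrace0 //.
have /(congr1 (fun B => C *m B *m D)) := LRLR.
by rewrite mulmx0 mul0mx !mulmxA CL mul1mx -(mulmxA _ R) RD mulmx1.
Qed.

Definition traces_mx (R : comNzRingType) (A : 'M[R]_n) (d : nat) : 'M[R]_d :=
  \matrix_(i, j) \tr (A ^+ i *m A ^+ j).

Lemma map_traces_mx (R S : comNzRingType) (f : {rmorphism R -> S})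
    (A : 'M[R]_n) d : map_mx f (traces_mx A d) = traces_mx (map_mx f A) d.
Proof.
apply/matrixP => i j; rewrite !mxE -trace_map_mx map_mxM.
by rewrite !rmorphXn.
Qed.

(** Turns orthogonality of q(A) to the powers A^j, j < d, into a linear equation
    on the coefficient vector of q: being killed by [traces_mx A d]. *)
Lemma mul_traces_mx A (d : nat) (u : 'rV_d) j :
  (u *m traces_mx A d) 0 j = \tr (horner_mx A (rVpoly u) *m A ^+ j).
Proof.
rewrite mxE horner_rVpoly_sum mulmx_suml (raddf_sum (@mxtrace F n)) /=.
by apply: eq_bigr => i _; rewrite mxE -scalemxAl mxtraceZ.
Qed.

Lemma kermx_powers_traces A d :
  (kermx (powers_mx A d) <= kermx (traces_mx A d))%MS.
Proof.
apply/rV_subP => u /sub_kermxP uP; apply/sub_kermxP/rowP => j.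
by rewrite mul_traces_mx horner_rVpoly uP linear0 mul0mx mxtrace0 mxE.
Qed.

End TraceForm.

(** The rank hypothesis says that q(A) = 0 as soon as deg q < n and q(A) is
    orthogonal to all powers A^j with j < n. If (X - x)^2 h is the minimal
    polynomial, then q = (X - x) h contradicts its minimality, because
    (q(A) A^j)^2 = 0 for all j. *)
Lemma diagonalizable_traces (K : closedFieldType) (n' : nat) (A : 'M[K]_n'.+1) :
    (\rank (powers_mx A n'.+1) <= \rank (traces_mx A n'.+1))%N ->
  diagonalizable A.
Proof.
move=> rkA; set P := powers_mx A _ in rkA; set H := traces_mx A _ in rkA.
have kerHP : (kermx H <= kermx P)%MS.
  rewrite -(geq_leqif (mxrank_leqif_sup (kermx_powers_traces A _))).
  by rewrite !mxrank_ker leq_sub2l.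
have [r defm] := closed_field_poly_normal (mxminpoly A).
rewrite (monicP (mxminpoly_monic A)) scale1r in defm.
apply/diagonalizableP; exists r; last by rewrite defm.
apply: count_mem_uniq => x; have [xr|/count_memPn//] := boolP (x \in r).
have r_x := perm_to_rem xr; rewrite (seq.permP r_x) /= eqxx.
have [xrem|/count_memPn -> //] := boolP (x \in rem x r).
(* What remains is the case of a repeated root x, to be refuted. *)
have r_xx := perm_to_rem xrem; set s := rem x (rem x r) in r_xx.
pose h := \prod_(y <- s) ('X - y%:P); pose q := ('X - x%:P) * h.
have m_qx : mxminpoly A = ('X - x%:P) * q.
  by rewrite defm (perm_big _ r_x) big_cons (perm_big _ r_xx) big_cons.
have q_neq0 : q != 0.
  by rewrite mulf_neq0 ?polyXsubC_eq0 ?monic_neq0 ?monic_prod_XsubC.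
have size_m : size (mxminpoly A) = (size q).+1.
  by rewrite m_qx mulrC size_Mmonic ?monicXsubC ?size_XsubC ?addn2.
have size_q : (size q <= n'.+1)%N.
  rewrite -ltnS -size_m -(size_char_poly A) dvdp_leq ?mxminpoly_dvd_char //.
  by rewrite monic_neq0 ?char_poly_monic.
have : (poly_rV q <= kermx H)%MS.
  apply/sub_kermxP/rowP => j; rewrite mul_traces_mx poly_rV_K // mxE.
  have -> : A ^+ j = horner_mx A 'X^j by rewrite rmorphXn /= horner_mx_X.
  apply: mxtrace_square_zero; rewrite mulmxE -!rmorphM.
  apply/mxminpoly_minP; rewrite m_qx /q; apply/dvdpP.
  by exists (h * ('X^j * 'X^j)); ring.
move=> /submx_trans/(_ kerHP)/sub_kermxP uP.
have : mxminpoly A %| q.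
  by apply: mxminpoly_min; rewrite -(poly_rV_K size_q) horner_rVpoly uP linear0.
by move/(dvdp_leq q_neq0); rewrite size_m ltnn.
Qed.

(** * Self-adjoint matrices *)

Section Adjointable.

Variable K : numClosedFieldType.

Lemma adjM m n p (A : 'M[K]_(m, n)) (B : 'M[K]_(n, p)) :
  adj (A *m B) = adj B *m adj A.
Proof. by rewrite trmx_mul map_mxM. Qed.

Lemma adjK m n (A : 'M[K]_(m, n)) : adj (adj A) = A.
Proof. by apply/matrixP => i j; rewrite !mxE conjCK. Qed.

Lemma mxtrace_adj_eq0 m n (A : 'M[K]_(m, n)) : \tr (A *m adj A) = 0 -> A = 0.
Proof.
move=> trA; apply/matrixP => i j; rewrite mxE; apply/eqP.
rewrite -mul_conjC_eq0; apply/eqP.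
have ge0 k : true -> 0 <= \sum_l A k l * (A k l)^*.
  by rewrite sumr_ge0 // => l _; rewrite mul_conjC_ge0.
have /psumr_eq0P/(_ i isT) : \sum_k \sum_l A k l * (A k l)^* = 0.
  rewrite -[RHS]trA; apply: eq_bigr => k _; rewrite mxE.
  by apply: eq_bigr => l _; rewrite !mxE.
move=> /(_ ge0)/psumr_eq0P-> // l _; exact: mul_conjC_ge0.
Qed.

Lemma unitmx_gram m n (T : 'M[K]_(m, n)) : row_free T -> T *m adj T \in unitmx.
Proof.
move=> Tfree; rewrite -row_free_unit; apply: inj_row_free => u uTT.
apply: (row_free_inj Tfree); rewrite mul0mx; apply: mxtrace_adj_eq0.
by rewrite adjM mulmxA -(mulmxA u) uTT mul0mx mxtrace0.
Qed.

(** The hypothesis is self-adjointness for the positive definite form of Gram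
    matrix M = T T^*. For X = q(A), the adjoint X' = M X^* M^-1 is obtained from
    q by conjugating its coefficients, so tr (X X') = 0 whenever X is orthogonal
    to all powers of A. Writing M^-1 = L^* L with L = T^* M^-1, this trace is the
    sum of the squared moduli of the entries of L X T, which gives X = 0. *)
Lemma rank_traces_adjointable n' p (A : 'M[K]_n'.+1) (T : 'M[K]_(n'.+1, p)) d :
    row_free T -> A *m (T *m adj T) = T *m adj T *m adj A ->
  (\rank (powers_mx A d) <= \rank (traces_mx A d))%N.
Proof.
move=> Tfree; have := unitmx_gram Tfree; set M := T *m adj T => Munit AM.
have adjMM : adj M = M by rewrite adjM adjK.
have AXM k : A ^+ k *m M = M *m adj (A ^+ k).
  elim: k => [|k IHk]; first by rewrite !expr0 trmx1 map_mx1 mul1mx mulmx1.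
  rewrite {1}exprS -mulmxE -mulmxA IHk mulmxA AM -mulmxA -adjM.
  by rewrite exprSr.
suff /mxrankS : (kermx (traces_mx A d) <= kermx (powers_mx A d))%MS.
  rewrite !mxrank_ker => le_ker.
  have := rank_leq_row (powers_mx A d); have := rank_leq_row (traces_mx A d).
  by move: le_ker; lia.
apply/rV_subP => u /sub_kermxP uH; apply/sub_kermxP.
set X := horner_mx A (rVpoly u).
suff X0 : X = 0 by apply/eqP; rewrite -vec_mx_eq0 -horner_rVpoly -/X X0.
pose X' := \sum_j (u 0 j)^* *: A ^+ j.
have trXX' : \tr (X *m X') = 0.
  rewrite mulmx_sumr raddf_sum /= big1 // => j _.
  by rewrite -scalemxAr mxtraceZ -mul_traces_mx uH mxE mulr0.
have X'M : X' *m M = M *m adj X.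
  rewrite /X horner_rVpoly_sum mulmx_suml !raddf_sum /=; apply: eq_bigr => j _.
  by rewrite !linearZ /= map_mxZ -scalemxAr -scalemxAl AXM.
pose L := adj T *m invmx M.
have TL : T *m L = 1%:M by rewrite mulmxA mulmxV.
have adjLL : adj L *m L = invmx M.
  rewrite adjM adjK trmx_inv map_invmx adjMM !mulmxA -(mulmxA _ T).
  by rewrite mulVmx ?mul1mx.
have TT : T *m adj T = M by [].
clearbody L M; have : L *m X *m T = 0.
  apply: mxtrace_adj_eq0; rewrite (adjM _ T) (adjM L) !mulmxA.
  rewrite -(mulmxA _ T) TT mxtrace_mulC !mulmxA adjLL -(mulmxA _ M) -X'M.
  by rewrite mxtrace_mulC -mulmxA mulKVmx // mxtrace_mulC.
move=> /(congr1 (mulmx T)); rewrite !mulmxA TL mul1mx mulmx0 => XT.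
by apply: (row_free_inj Tfree); rewrite mul0mx.
Qed.

End Adjointable.

(** * Nonvanishing loci of polynomials *)

Section Zariski.

Variables (K : numClosedFieldType) (N : nat).
Implicit Type (p q : {mpoly K[N]}) (z : 'I_N -> K).

Lemma meval_line p (u v : 'I_N -> K) :
  exists P : {poly K}, forall t, P.[t] = p.@[fun j => u j + v j * t].
Proof.
exists (mmap polyC (fun j => (u j)%:P + (v j)%:P * 'X) p) => t.
rewrite mevalE /mmap horner_sum; apply: eq_bigr => m _.
rewrite hornerM hornerC /mmap1 horner_prod; congr (_ * _).
by apply: eq_bigr => j _; rewrite horner_exp !hornerE.
Qed.

Lemma nat_nonroot (P : {poly K}) : P != 0 -> exists k : nat, P.[k%:R] != 0.
Proof.
move=> P0; pose s := [seq k%:R : K | k <- iota 0 (size P)].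
have /allPn[_ /mapP[k _ ->] Pk] : ~~ all (root P) s.
  apply/negP => Ps; have : uniq s.
    by rewrite map_inj_uniq ?iota_uniq // => i j /eqP; rewrite eqr_nat => /eqP.
  by move/(max_poly_roots P0 Ps); rewrite size_map size_iota ltnn.
by exists k.
Qed.

(** On the line t |-> Re z + t Im z, the polynomial does not vanish at t = 'i,
    hence has finitely many roots there; the integral values of t give real
    points. *)
Lemma meval_real_point p z : p.@[z] != 0 ->
  exists2 x, (forall i, x i \is Num.real) & p.@[x] != 0.
Proof.
move=> pz.
have [P PE] := meval_line p (fun i => 'Re (z i)) (fun i => 'Im (z i)).
have P0 : P != 0.
  apply: contraNneq pz => P0; have := PE 'i; rewrite P0 horner0 => /eqP.
  rewrite eq_sym; congr (_ == _); apply: meval_eq => i.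
  by rewrite [RHS]Crect mulrC.
have [k Pk] := nat_nonroot P0; exists (fun i => 'Re (z i) + 'Im (z i) * k%:R).
  by move=> i; rewrite rpredD ?rpredM ?Creal_Re ?Creal_Im ?realn.
by rewrite -PE.
Qed.

(** Irreducibility of affine space, by restriction to the line through z and w:
    there p and q become nonzero polynomials in one variable. *)
Lemma meval_common_point p q z w : p.@[z] != 0 -> q.@[w] != 0 ->
  exists x, (p * q).@[x] != 0.
Proof.
move=> pz qw; pose d i := w i - z i.
have [[P PE] [Q QE]] := (meval_line p z d, meval_line q z d).
have P0 : P != 0.
  apply: contraNneq pz => P0; have := PE 0; rewrite P0 horner0 => /eqP.
  rewrite eq_sym; congr (_ == _); apply: meval_eq => i.
  by rewrite mulr0 addr0.
have Q0 : Q != 0.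
  apply: contraNneq qw => Q0; have := QE 1; rewrite Q0 horner0 => /eqP.
  rewrite eq_sym; congr (_ == _); apply: meval_eq => i.
  by rewrite mulr1 addrC subrK.
have [k] := nat_nonroot (mulf_neq0 P0 Q0).
by rewrite hornerM PE QE -mevalM; eexists; eassumption.
Qed.

Lemma meval_prod_point (I : finType) (p : I -> {mpoly K[N]}) :
  (forall i, exists z, (p i).@[z] != 0) -> exists z, (\prod_i p i).@[z] != 0.
Proof.
move=> pP; apply: (big_rec (fun q => exists z, q.@[z] != 0)).
  by exists (fun=> 0); rewrite meval1 oner_neq0.
move=> i q _ [w qw]; have [z pz] := pP i; exact: meval_common_point pz qw.
Qed.

(** Pick constant C and D with C (A z0) D an identity matrix of size the rank of
    A z0. The determinant of C A D then plays the role of a nonzero minor. *)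
Lemma rank_semicontinuous m n (A : 'M[{mpoly K[N]}]_(m, n)) z0 :
  exists2 p, p.@[z0] != 0 & forall z, p.@[z] != 0 ->
    (\rank (map_mx (meval z0) A) <= \rank (map_mx (meval z) A))%N.
Proof.
set A0 := map_mx _ A; have [C CA] := row_fullP (col_base_full A0).
have [D AD] := row_freeP (row_base_free A0).
pose B := map_mx (@mpolyC N K) C *m A *m map_mx (@mpolyC N K) D.
have BE z : map_mx (meval z) B = C *m map_mx (meval z) A *m D.
  have mapC a b (X : 'M[K]_(a, b)) :
      map_mx (meval z) (map_mx (@mpolyC N K) X) = X.
    by apply/matrixP => i j; rewrite !mxE mevalC.
  by rewrite !map_mxM !mapC.
exists (\det B) => [|z]; rewrite -det_map_mx BE.
  rewrite -/A0 -[X in C *m X]mulmx_base (mulmxA C (col_base A0)) CA.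
  by rewrite mul1mx AD det1 oner_neq0.
rewrite -unitfE -unitmxE -row_free_unit -row_leq_rank => /leq_trans -> //.
exact: leq_trans (mxrankM_maxl _ _) (mxrankM_maxr _ _).
Qed.

(** The transport from real points: the rank of the powers at a generic z is
    largest, is bounded at some real x by the rank of the trace form, and the
    latter can only grow from x to a generic z. *)
Lemma diagonalizable_dense n' (A : 'M[{mpoly K[N]}]_n'.+1) :
    (forall x, (forall i, x i \is Num.real) ->
     \rank (powers_mx (map_mx (meval x) A) n'.+1) <=
     \rank (traces_mx (map_mx (meval x) A) n'.+1))%N ->
  exists p : {mpoly K[N]}, (exists z, p.@[z] != 0) /\
    forall z, p.@[z] != 0 -> diagonalizable (map_mx (meval z) A).
Proof.
move=> realA; pose rk z := \rank (powers_mx (map_mx (meval z) A) n'.+1).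
have [z0 z0max] : exists z0, forall z, (rk z <= rk z0)%N.
  have ubr r : `[< exists z, rk z = r >] -> (r <= n'.+1)%N.
    by move=> /asboolP[z <-]; apply: rank_leq_row.
  have exr : exists r, `[< exists z, rk z = r >].
    by exists (rk (fun=> 0)); apply/asboolP; exists (fun=> 0).
  have [r /asboolP[z0 <-] rmax] := ex_maxnP exr ubr.
  by exists z0 => z; apply: rmax; apply/asboolP; exists z.
have [p pz0 prk] := rank_semicontinuous (powers_mx A n'.+1) z0.
have [x xreal px] := meval_real_point pz0.
have [q qx qrk] := rank_semicontinuous (traces_mx A n'.+1) x.
exists q; split; first by exists x.
move=> z qz; apply: diagonalizable_traces.
apply: leq_trans (z0max z) _; rewrite /rk -map_powers_mx.
apply: leq_trans (prk x px) _; rewrite map_powers_mx.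
apply: leq_trans (realA x xreal) _.
by have := qrk z qz; rewrite !map_traces_mx.
Qed.

End Zariski.

(** * Commutation of the theta elements *)

Lemma tperm_star (T : finType) (i j k : T) : j != i -> j != k ->
  (tperm i j * tperm i k = tperm i k * tperm j k)%g.
Proof.
move=> ji jk; rewrite conjgC tpermJ tpermL [tperm k _]tpermC tpermD //.
  by rewrite eq_sym.
by rewrite eq_sym.
Qed.

Lemma tperm_disjoint_comm (T : finType) (i j k l : T) :
    j != i -> l != i -> j != k -> l != k ->
  (tperm i k * tperm j l = tperm j l * tperm i k)%g.
Proof. by move=> ji li jk lk; rewrite conjgC tpermJ !tpermD. Qed.

(** Isolate the terms in S = s_ij: theta_i = a S + X and theta_j = - a S + Y,
    with a = 1 / (z_i - z_j). Only the pairs s_ik, s_jk sharing an index k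
    contribute to X Y - Y X; their two products are the two 3-cycles on i, j, k,
    which also are S s_ik and S s_jk. The claim then reduces to the partial
    fraction identity [coef]. *)
Lemma theta_comm (K : fieldType) (N n : nat)
    (rG : mx_representation K [set: 'S_N] n) (z : 'I_N -> K) (i j : 'I_N) :
  injective z -> comm_mx (theta rG z i) (theta rG z j).
Proof.
move=> z_inj; have [<-//|i_neq_j] := eqVneq i j.
have rM (s t : 'S_N) : rG (s * t)%g = rG s *m rG t by rewrite repr_mxM ?inE.
pose S := rG (tperm i j); pose a := (z i - z j)^-1.
pose U k := rG (tperm i k); pose x k := (z i - z k)^-1.
pose V k := rG (tperm j k); pose y k := (z j - z k)^-1.
pose Q k := (k != i) && (k != j).
pose X := \sum_(k | Q k) x k *: U k; pose Y := \sum_(k | Q k) y k *: V k.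
have theta_i : theta rG z i = a *: S + X by rewrite /theta (bigD1 j) // eq_sym.
have theta_j : theta rG z j = - a *: S + Y.
  rewrite /theta (bigD1 i) //= tpermC -invrN opprB.
  by congr (_ + _); apply: eq_bigl => k; rewrite andbC.
have UV k : Q k -> U k *m V k = S *m U k.
  by case/andP=> ki kj; rewrite -!rM [in RHS]tperm_star // eq_sym.
have VS k : Q k -> V k *m S = S *m U k.
  case/andP=> ki kj; rewrite -!rM [tperm i j]tpermC tperm_star //.
  by rewrite [tperm k i]tpermC.
have US k : Q k -> U k *m S = S *m V k.
  case/andP=> ki kj; rewrite -!rM tperm_star //.
  by rewrite [tperm k j]tpermC.
have VU k : Q k -> V k *m U k = S *m V k.
  move=> Qk; rewrite -US //; case/andP: Qk => ki kj; rewrite -!rM.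
  rewrite ![tperm _ k]tpermC tperm_star 1?[tperm j i]tpermC // eq_sym //.
have comUV k l : Q k -> Q l -> l != k -> U k *m V l = V l *m U k.
  case/andP=> ki kj /andP[li lj] lk.
  by rewrite -!rM tperm_disjoint_comm // eq_sym.
have XY : X *m Y = Y *m X + \sum_(k | Q k) (x k * y k) *: (S *m U k - S *m V k).
  rewrite /X /Y mulmx_suml [Y in Y + _]mulmx_sumr -big_split /=.
  apply: eq_bigr => k Qk; rewrite mulmx_sumr mulmx_suml.
  rewrite (bigD1 k) //= [in RHS](bigD1 k) //= addrAC; congr (_ + _); last first.
    apply: eq_bigr => l /andP[Ql lk].
    by rewrite -!scalemxAl -!scalemxAr comUV // !scalerA mulrC.
  rewrite -!scalemxAl -!scalemxAr UV // VU // !scalerA [y k * _]mulrC.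
  by rewrite scalerBr addrC subrK.
have coef k : Q k -> x k * y k = a * y k - a * x k.
  case/andP=> ki kj.
  have := i_neq_j; rewrite -(inj_eq z_inj) -subr_eq0 => zij.
  have := ki; rewrite eq_sym -(inj_eq z_inj) -subr_eq0 => zik.
  have := kj; rewrite eq_sym -(inj_eq z_inj) -subr_eq0 => zjk.
  by rewrite /x /y /a; field; rewrite zij zik zjk.
have SX : S *m X = \sum_(k | Q k) x k *: (S *m U k).
  by rewrite mulmx_sumr; apply: eq_bigr => k _; rewrite scalemxAr.
have SY : S *m Y = \sum_(k | Q k) y k *: (S *m V k).
  by rewrite mulmx_sumr; apply: eq_bigr => k _; rewrite scalemxAr.
have XS : X *m S = \sum_(k | Q k) x k *: (S *m V k).
  by rewrite mulmx_suml; apply: eq_bigr => k Qk; rewrite -scalemxAl US.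
have YS : Y *m S = \sum_(k | Q k) y k *: (S *m U k).
  by rewrite mulmx_suml; apply: eq_bigr => k Qk; rewrite -scalemxAl VS.
have {}XY : X *m Y = Y *m X + a *: (Y *m S - S *m X + X *m S - S *m Y).
  rewrite XY SX SY XS YS -!sumrN -!big_split scaler_sumr; congr (_ + _).
  apply: eq_bigr => k Qk; rewrite coef //=; apply/matrixP => ? ?.
  by rewrite !mxE; ring.
rewrite /comm_mx theta_i theta_j !mulmxDl !mulmxDr -!scalemxAl -!scalemxAr XY.
by apply/matrixP => ? ?; rewrite !mxE; ring.
Qed.

(** * Self-adjointness at real points *)

(** Unitary trick: with T the row of all the matrices rG g, the Gram matrix
    T T^* is the sum over G of the rG g (rG g)^*. Giving T rather than the form
    itself records positive definiteness as row-freeness. *)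
Lemma invariant_gram (K : numClosedFieldType) (gT : finGroupType)
    (G : {group gT}) n (rG : mx_representation K G n) :
  exists p, exists2 T : 'M[K]_(n, p), row_free T &
    {in G, forall g, rG g *m (T *m adj T) *m adj (rG g) = T *m adj T}.
Proof.
pose T := \mxrow_(k < #|G|) rG (enum_val k); eexists; exists T.
  apply: inj_row_free => v; rewrite mul_mxrow => vT.
  pose k := enum_rank_in (group1 G) 1%g.
  have : submxrow (\mxrow_(k < #|G|) (v *m rG (enum_val k))) k = 0.
    by rewrite vT; apply/matrixP => ? ?; rewrite !mxE.
  by rewrite mxrowK enum_rankK_in // repr_mx1 mulmx1.
have TT : T *m adj T = \sum_(h in G) rG h *m adj (rG h).
  have -> : adj T = \mxcol_(k < #|G|) adj (rG (enum_val k)).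
    by apply/matrixP => ? ?; rewrite !mxE.
  by rewrite mul_mxrow_mxcol [RHS]big_enum_val.
move=> g gG; rewrite TT mulmx_sumr mulmx_suml.
rewrite [RHS](reindex_inj (mulgI g)) /=.
apply: eq_big => [h|h hG]; first by rewrite groupMl.
by rewrite repr_mxM // adjM !mulmxA.
Qed.

Lemma rank_traces_transpositions (K : numClosedFieldType) N n'
    (rG : mx_representation K [set: 'S_N] n'.+1) (c : 'I_N -> K) i d :
    (forall j, c j \is Num.real) ->
  let A := \sum_(j < N | j != i) c j *: rG (tperm i j) in
  (\rank (powers_mx A d) <= \rank (traces_mx A d))%N.
Proof.
move=> creal /=; set A := \sum_(j | _) _.
have [p [T Tfree Tinv]] := invariant_gram rG.
apply: (@rank_traces_adjointable _ _ _ A _ d Tfree).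
rewrite /A mulmx_suml !raddf_sum /=; apply: eq_bigr => j _.
have -> : adj (c j *: rG (tperm i j)) = c j *: adj (rG (tperm i j)).
  by rewrite linearZ map_mxZ /= (CrealP (creal j)).
rewrite -scalemxAl -scalemxAr; congr (_ *: _).
have sG : tperm i j \in [set: 'S_N]%G by rewrite inE.
have := Tinv _ sG => {2}<-.
rewrite -[RHS]mulmxA -adjM -repr_mxM // tperm2 repr_mx1.
by rewrite trmx1 map_mx1 mulmx1.
Qed.

(** * Generic semisimplicity *)

Section ClearedDenominators.

Variables (K : numClosedFieldType) (N n : nat).
Variable rG : mx_representation K [set: 'S_N] n.

(** theta_i with its denominators cleared, that is, multiplied by the product of
    the z_i - z_k for k <> i. *)
Definition theta_num (i : 'I_N) : 'M[{mpoly K[N]}]_n :=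
  \sum_(j < N | j != i)
    (\prod_(k < N | (k != i) && (k != j)) ('X_i - 'X_k)) *:
      map_mx (@mpolyC N K) (rG (tperm i j)).

Lemma meval_theta_num (z : 'I_N -> K) i :
  map_mx (meval z) (theta_num i) =
  \sum_(j < N | j != i)
    (\prod_(k < N | (k != i) && (k != j)) (z i - z k)) *: rG (tperm i j).
Proof.
rewrite raddf_sum /=; apply: eq_bigr => j _; rewrite map_mxZ rmorph_prod /=.
congr (_ *: _); last by apply/matrixP => ? ?; rewrite !mxE mevalC.
by apply: eq_bigr => k _; rewrite mevalB !mevalXU.
Qed.

Lemma theta_numE (z : 'I_N -> K) i : injective z ->
  theta rG z i =
  (\prod_(k < N | k != i) (z i - z k))^-1 *: map_mx (meval z) (theta_num i).
Proof.
move=> z_inj; rewrite meval_theta_num scaler_sumr; apply: eq_bigr => j ji.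
rewrite scalerA (bigD1 j) //= invfM -mulrA mulVf ?mulr1 //.
apply/prodf_neq0 => k /andP[ki _].
by rewrite subr_eq0 (inj_eq z_inj) eq_sym.
Qed.

End ClearedDenominators.

Lemma theta_num_generically_diagonalizable (K : numClosedFieldType) (N n : nat)
    (rG : mx_representation K [set: 'S_N] n) i :
  exists p : {mpoly K[N]}, (exists z, p.@[z] != 0) /\
    forall z, p.@[z] != 0 -> diagonalizable (map_mx (meval z) (theta_num rG i)).
Proof.
case: n => [|n'] in rG *.
  exists 1; split; first by exists (fun=> 0); rewrite meval1 oner_neq0.
  by move=> z _; rewrite [map_mx _ _]flatmx0; apply: diagonalizable0.
apply: diagonalizable_dense => x xreal.
rewrite meval_theta_num; apply: rank_traces_transpositions => j.
by apply: rpred_prod => k _; rewrite rpredB.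
Qed.

Lemma theta_generically_semisimple (K : numClosedFieldType) (N n : nat)
    (rG : mx_representation K [set: 'S_N] n) :
  exists U : set ('I_N -> K),
    [/\ zariski_open_in (@distinct_coords K N) U,
        (U !=set0)%classic
      & forall z, U z -> codiagonalizable [seq theta rG z i | i : 'I_N]].
Proof.
have [p pP] := choice (theta_num_generically_diagonalizable rG).
have [z1 pz1] : exists z, (\prod_i p i).@[z] != 0.
  by apply: meval_prod_point => i; case: (pP i).
(* The nonvanishing locus of disc is the set of points with distinct
   coordinates; it has to be met by the other open sets. *)
pose disc : {mpoly K[N]} := \prod_i \prod_(j < N | j != i) ('X_i - 'X_j).
have disc_neq0 z : (disc.@[z] != 0) <-> injective z.
  rewrite /disc rmorph_prod; split=> [/prodf_neq0 dz i j zij|z_inj].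
    apply/eqP/negP => /negP ij; have := dz i isT.
    rewrite rmorph_prod /= => /prodf_neq0/(_ j); rewrite eq_sym => /(_ ij).
    by rewrite mevalB !mevalXU zij subrr eqxx.
  apply/prodf_neq0 => i _; rewrite rmorph_prod; apply/prodf_neq0 => j ji.
  by rewrite /= mevalB !mevalXU subr_eq0 (inj_eq z_inj) eq_sym.
have disc_nat : disc.@[fun i : 'I_N => i%:R] != 0.
  by apply/disc_neq0 => i j /eqP; rewrite eqr_nat => /eqP/ord_inj.
have [z0 pz0] := meval_common_point disc_nat pz1.
pose O := [set z : 'I_N -> K | (\prod_i p i).@[z] != 0]%classic.
exists (@distinct_coords K N `&` O)%classic; split.
- exists O => //; exists [set \prod_i p i]%classic; apply/seteqP.
  by split=> z /=; [move=> pz; exists (\prod_i p i) | case=> q ->].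
- move: pz0; rewrite mevalM mulf_eq0 negb_or => /andP[dz0 pz0].
  by exists z0; split; [apply/disc_neq0 | ].
move=> z [z_inj pz]; apply/codiagonalizableP; split.
  by move=> _ _ /mapP[i _ ->] /mapP[j _ ->]; apply: theta_comm.
move=> _ /mapP[i _ ->]; rewrite theta_numE //; apply: diagonalizableZ.
apply: (pP i).2; move: pz; rewrite /O /= rmorph_prod => /prodf_neq0.
exact.
Qed.

Local Open Scope complex_scope.

Theorem corollary6p2 (R : realType) (N : nat) (la : seq nat)
    (hla : is_partition N la) :
  exists U : set ('I_N -> R[i]),
    [/\ zariski_open_in (@distinct_coords R[i] N) U,
        (U !=set0)%classic
      & forall z, U z ->
          codiagonalizable [seq theta (specht R[i] N la) z i | i : 'I_N]].
Proof. exact: theta_generically_semisimple. Qed.
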